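(* Let $0<m\le M<\infty$, $\rho>0$, and let $l\ge 1$ be an integer. There exist positive constants $C_1,C_2$ depending only on $m,M,l,\rho$ such that the following holds. Let $d\geq l$, $h>0$, and let $F^0=F_{A^0,X^0}$ be a signal with $d$ nodes that satisfies assumption $A(m,M)$ and forms an $(l,h,\rho)$-cluster $X^0_l=\{x^0_\kappa,x^0_{\kappa+1},\ldots,x^0_{\kappa+l-1}\}$. Then there exist parameters $A^1,X^1\in\mathbb{R}^d$, satisfying assumption $A(\frac{m}{2},2M)$, such that, with $X^1_l=\{x^1_\kappa,x^1_{\kappa+1},\ldots,x^1_{\kappa+l-1}\}$, $$d(X^0_l,X^1_l)\ \ge\ C_1h,$$ while for $F^1=F_{A^1,X^1}$ and for each $s\in\mathbb{R}$ with $|s|\le\frac{1}{2\pi h}$ we have $$|\mathcal{F}(F^0)(s)-\mathcal{F}(F^1)(s)|\ \le\ C_2\,|hs|^{2l-1}.$$ In particular, for $s\in[-N,N]$ with $N\le\frac{1}{2\pi h}$, this difference does not exceed $C_2(hN)^{2l-1}$.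
   Context: A signal with $d$ nodes is $F_{A,X}(x)=\sum_{j=1}^d a_j\delta(x-x_j)$, where $\delta$ is the Dirac delta, $A=(a_1,\ldots,a_d)\in\mathbb{R}^d$ are the amplitudes and $X=(x_1,\ldots,x_d)\in\mathbb{R}^d$ are the nodes, always ordered so that $x_1\le x_2\le\cdots\le x_d$. Its Fourier transform is $\mathcal{F}(F)(s)=\int_{-\infty}^{\infty}F(x)e^{-isx}\,dx$, i.e. $\mathcal{F}(F_{A,X})(s)=\sum_{j=1}^d a_je^{-isx_j}$. Assumption $A(m,M)$: $0<m\le|a_j|\le M<\infty$ for $j=1,\ldots,d$ (and $A(\frac m2,2M)$ is the same condition with $m,M$ replaced by $\frac m2,2M$). A signal $F_{A,X}$ forms an $(l,h,\rho)$-cluster if there is an interval $I\subset\mathbb{R}$ of length $h$ which contains exactly $l$ nodes $X_l=\{x_\kappa,x_{\kappa+1},\ldots,x_{\kappa+l-1}\}$ of $F_{A,X}$, while the minimal distance between the nodes in $X_l$ is at least $\rho h$, $\rho>0$. For two ordered subsets $V=(v_1,\ldots,v_q)$ and $W=(w_1,\ldots,w_q)$ of $\mathbb{R}$, $d(V,W)=\max_{1\le s\le q}|v_s-w_s|$. *)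

(* Defs.v *)
From HB Require Import structures.
From mathcomp Require Import all_boot all_order all_algebra.
From mathcomp Require Import complex.
From mathcomp Require Import reals trigo.

Set Implicit Arguments.
Unset Strict Implicit.
Unset Printing Implicit Defensive.

Import Order.TTheory GRing.Theory Num.Theory.
Local Open Scope ring_scope.

(* A finite combination F of Dirac deltas is represented by the linear
   functional phi |-> \int F(x) phi(x) dx, defined for every phi : R -> R[i]. *)
Definition delta (R : realType) (x : R) (phi : R -> R[i]) : R[i] := phi x.

Definition signal (R : realType) (d : nat) (A X : 'rV[R]_d)
    (phi : R -> R[i]) : R[i] :=
  \sum_(j < d) (A 0 j)%:C%C * delta (X 0 j) phi.

(* exp(i t) *)
Definition expi (R : realType) (t : R) : R[i] := (cos t +i* sin t)%C.

Definition fourier (R : realType) (F : (R -> R[i]) -> R[i]) (s : R) : R[i] :=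
  F (fun x => expi (- (s * x))).

Definition ordered_nodes (R : realType) (d : nat) (X : 'rV[R]_d) : Prop :=
  forall i j : 'I_d, (i <= j)%N -> X 0 i <= X 0 j.

Definition amplitude_bounds (R : realType) (m M : R) (d : nat)
    (A : 'rV[R]_d) : Prop :=
  0 < m /\ forall j : 'I_d, m <= `|A 0 j| <= M.

(* (x_k, ..., x_(k+l-1)), with nodes numbered from 0 *)
Definition subnodes (R : realType) (d k l : nat) (hkl : (k + l <= d)%N)
    (X : 'rV[R]_d) : 'rV[R]_l :=
  \row_(s < l) X 0 (widen_ord hkl (rshift k s)).

(* The nodes lying in the interval of length h are exactly those with index
   in [k, k + l); the booleans bl and br let the interval be open, closed or
   half-open. *)
Definition cluster (R : realType) (l : nat) (h rho : R) (d : nat)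
    (X : 'rV[R]_d) (k : nat) (hkl : (k + l <= d)%N) : Prop :=
  (exists (c : R) (bl br : bool), forall j : 'I_d,
     (X 0 j \in Interval (BSide bl c) (BSide br (c + h)))
     = (k <= j < k + l)%N) /\
  (forall s t : 'I_l, s != t ->
     rho * h <= `|subnodes hkl X 0 s - subnodes hkl X 0 t|).

Definition dist_nodes (R : realType) (q : nat) (V W : 'rV[R]_q) : R :=
  \big[Num.max/0]_(s < q) `|V 0 s - W 0 s|.

(* Main.v *)
From HB Require Import structures.
From mathcomp Require Import all_boot all_order all_fingroup all_algebra.
From mathcomp Require Import complex polyrcf.
From mathcomp Require Import reals trigo topology normedtype derive realfun.
From mathcomp Require Import ring lra zify.
Require Import Defs.

(** After an affine change of variable the cluster lies in [[0, 1]], and it is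
enough to find, for nodes [x] and amplitudes [a], new nodes [y] and amplitudes
[b] with the same moments of orders [0, ..., 2l-2]: the difference of the two
Fourier transforms then only sees the Taylor remainder of order [2l-1] of
[exp(i u)] ([matched_spectrum_le]).  All other nodes of the signal stay fixed.

Matching moments come from divided differences.  The divided difference over
the [2l] points [x_i], [y_i] kills every polynomial of degree at most [2l-2],
so, for any [y], its weights at the [x_i] and the opposites of its weights at
the [y_i] are amplitudes with equal moments ([matching_moments]).  The weights
at [x_i] have to be proportional to the prescribed [a_i], which is a condition
on the polynomial with roots [y_k]: with [Q = prod_k (X - x_k)], it must take
the values [t / (a_i Q'(x_i))] at the [x_i].  This determines it as [Q + V],
where [V] is a Lagrange interpolant proportional to [t].  For [t] small
compared with [m], [rho] and [l], [Q + V] still changes sign around each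
[x_i], hence has [l] real roots, one close to each [x_i]
([perturbed_real_roots]).  Closeness keeps the amplitudes within a factor [2]
([matching_amplitude_le]), while the prescribed value of [Q + V] at [x_i]
bounds the displacement of the node from below, with a direction given by the
sign of [t] ([matching_displacement]).

Moved nodes may cross nodes outside the cluster, so the new signal has to be
sorted again.  The first node of the cluster is sent to the right, where the
next node is at least [rho h] away; if the cluster is a single node, it is sent
to the side of the interval that leaves room.  Then all nodes of index at least
(respectively at most) the one considered stay beyond its new position, and by
the pigeonhole principle so does the node that gets its index after sorting
([sorted_ge], [sorted_le]). *)

Set Implicit Arguments.
Unset Strict Implicit.
Unset Printing Implicit Defensive.

Import Order.TTheory GRing.Theory Num.Theory numFieldNormedType.Exports.
Local Open Scope ring_scope.

(** * Divided differences and matching moments *)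

Section DividedDifferences.
Variables (F : fieldType).

(** The derivative at [y i] of the monic polynomial with roots [y k]. *)
Definition nodal_weight (I : finType) (y : I -> F) (i : I) : F :=
  \prod_(k | k != i) (y i - y k).

Lemma nodal_weight_neq0 (I : finType) (y : I -> F) i :
  injective y -> nodal_weight y i != 0.
Proof.
move=> y_inj; apply/prodf_neq0 => k ki.
by rewrite subr_eq0 (inj_eq y_inj) eq_sym.
Qed.

Definition interpolant (I : finType) (y v : I -> F) : {poly F} :=
  \sum_i (v i / nodal_weight y i) *: \prod_(k | k != i) ('X - (y k)%:P).

Lemma interpolantE (I : finType) (y v : I -> F) j :
  injective y -> (interpolant y v).[y j] = v j.
Proof.
move=> y_inj; rewrite horner_sum (bigD1 j) //= [X in _ + X]big1 => [|i ij].
  rewrite addr0 hornerZ horner_prod.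
  rewrite (eq_bigr (fun k => y j - y k)) => [|k _]; last by rewrite hornerXsubC.
  by rewrite -/(nodal_weight y j) divfK ?nodal_weight_neq0.
rewrite hornerZ horner_prod (bigD1 j) /=; last by rewrite eq_sym.
by rewrite hornerXsubC subrr mul0r mulr0.
Qed.

Lemma size_prod_XsubC_neq (I : finType) (y : I -> F) i :
  size (\prod_(k | k != i) ('X - (y k)%:P)) = #|I|.
Proof.
have I_gt0 : (0 < #|I|)%N by apply/card_gt0P; exists i.
rewrite size_prod => [|k _]; last by rewrite polyXsubC_eq0.
rewrite (eq_bigr (fun=> 2%N)) => [|k _]; last by rewrite size_XsubC.
rewrite sum_nat_const cardC1; lia.
Qed.

Lemma size_interpolant (I : finType) (y v : I -> F) :
  (size (interpolant y v) <= #|I|)%N.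
Proof.
apply: (leq_trans (size_sum _ _ _)); apply/bigmax_leqP => i _.
by rewrite (leq_trans (size_scale_leq _ _)) // size_prod_XsubC_neq.
Qed.

Lemma poly_eq_on_nodes (I : finType) (y : I -> F) (p q : {poly F}) :
  injective y -> (size p <= #|I|)%N -> (size q <= #|I|)%N ->
  (forall i, p.[y i] = q.[y i]) -> p = q.
Proof.
move=> y_inj sp sq pq; apply/eqP; rewrite -subr_eq0; apply/eqP.
apply: (@roots_geq_poly_eq0 _ _ [seq y i | i <- enum I]).
- apply/allP => _ /mapP[i _ ->].
  by rewrite rootE hornerD hornerN pq subrr.
- by rewrite map_inj_uniq // enum_uniq.
- by rewrite size_map -cardE (leq_trans (size_polyD _ _)) // geq_max size_polyN sp.
Qed.

(** The sum is the coefficient of degree [#|I| - 1] of the Lagrange interpolant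
of [p], that is, of [p] itself. *)
Lemma divided_difference_eq0 (I : finType) (y : I -> F) (p : {poly F}) :
  injective y -> (size p < #|I|)%N -> \sum_i p.[y i] / nodal_weight y i = 0.
Proof.
move=> y_inj sp.
have pE : p = interpolant y (fun i => p.[y i]).
  apply: (poly_eq_on_nodes y_inj (ltnW sp) (size_interpolant _ _)) => i.
  by rewrite interpolantE.
have := congr1 (fun q : {poly F} => q`_(#|I|.-1)) pE.
rewrite nth_default; last by rewrite -ltnS prednK // (leq_trans _ sp).
rewrite coef_sum => /esym; apply: etrans; apply: eq_bigr => i _.
rewrite coefZ -[X in _`_X.-1](size_prod_XsubC_neq y i) -lead_coefE.
by rewrite (monicP (monic_prod_XsubC _ _ _)) mulr1.
Qed.

(** Splits the divided difference over the disjoint union of two families of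
nodes. *)
Lemma divided_difference2_eq0 (I : finType) (x y : I -> F) (p : {poly F}) :
  injective x -> injective y -> (forall i j, x i != y j) ->
  (size p < #|I|.*2)%N ->
  \sum_i p.[x i] / (nodal_weight x i * \prod_k (x i - y k)) +
  \sum_i p.[y i] / (nodal_weight y i * \prod_k (y i - x k)) = 0.
Proof.
move=> x_inj y_inj xy sp.
pose z (u : I + I) := match u with inl i => x i | inr i => y i end.
have z_inj : injective z.
  case=> i [] j /= => [/x_inj -> | /eqP | /eqP | /y_inj ->] //.
  - by rewrite (negbTE (xy _ _)).
  - by rewrite eq_sym (negbTE (xy _ _)).
have := @divided_difference_eq0 _ z p z_inj; rewrite card_sum addnn => /(_ sp).
rewrite big_sumType /=; apply: etrans; congr (_ + _).
  by apply: eq_bigr => i _; rewrite /nodal_weight big_sumType /=.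
by apply: eq_bigr => i _; rewrite /nodal_weight big_sumType /= [X in _ / X]mulrC.
Qed.

(** Up to the factor [t], the weight of [x i] in the divided difference over all
the nodes of [x] and [y]. *)
Definition matching_amplitude (I : finType) (t : F) (x y : I -> F) (i : I) : F :=
  t / (nodal_weight x i * \prod_k (x i - y k)).

Lemma matching_moments (I : finType) (t : F) (x y : I -> F) (p : {poly F}) :
  injective x -> injective y -> (forall i j, x i != y j) ->
  (size p < #|I|.*2)%N ->
  \sum_i matching_amplitude t x y i * p.[x i] =
  \sum_i matching_amplitude (- t) y x i * p.[y i].
Proof.
move=> x_inj y_inj xy sp; apply/eqP; rewrite -subr_eq0; apply/eqP.
have := congr1 ( *%R t) (divided_difference2_eq0 x_inj y_inj xy sp).
rewrite mulr0 => dd; rewrite -[RHS]dd mulrDr !mulr_sumr -sumrN; congr (_ + _).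
  by apply: eq_bigr => i _; rewrite /matching_amplitude mulrAC mulrA.
by apply: eq_bigr => i _; rewrite /matching_amplitude mulrAC !mulNr opprK mulrA.
Qed.

End DividedDifferences.

(** * Perturbing a separated configuration *)

Section Perturbation.
Variables (R : rcfType).

Lemma le_norm_prod (I : finType) (i : I) (b : R) (f : I -> R) :
  0 <= b -> (forall k, k != i -> b <= `|f k|) ->
  b ^+ #|I|.-1 <= `|\prod_(k | k != i) f k|.
Proof.
move=> b0 bf; rewrite normr_prod -(cardC1 i) -prodr_const.
by apply: ler_prod => k ki; rewrite b0 bf.
Qed.

Lemma norm_prod_le (I : finType) (i : I) (b : R) (f : I -> R) :
  (forall k, k != i -> `|f k| <= b) ->
  `|\prod_(k | k != i) f k| <= b ^+ #|I|.-1.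
Proof.
move=> fb; rewrite normr_prod -(cardC1 i) -prodr_const.
by apply: ler_prod => k ki; rewrite normr_ge0 fb.
Qed.

Lemma exprD1_le (e : R) k : 0 <= e -> k%:R * e <= 1 / 2 -> (1 + e) ^+ k <= 1 + 2 * (k%:R * e).
Proof.
move=> e0; elim: k => [|k IHk] ke; first by rewrite expr0 mul0r; lra.
have {}ke : k%:R * e <= 1 / 2 - e by move: ke; rewrite -[k.+1%:R]natr1 mulrDl mul1r; set u := k%:R * e; lra.
have {}IHk : (1 + e) ^+ k <= 1 + 2 * (k%:R * e) by apply: IHk; lra.
rewrite exprSr -[k.+1%:R]natr1 [(_ + 1) * e]mulrDl mul1r; apply: (le_trans (ler_wpM2r _ IHk)); first lra.
set u := k%:R * e in ke *; have := ler_wpM2l e0 ke; have := sqr_ge0 e; nra.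
Qed.

Lemma horner_interpolant_le (I : finType) (x v : I -> R) (rho B K z : R) :
  0 < rho -> 0 <= B -> (forall i k, i != k -> rho <= `|x i - x k|) ->
  (forall i, `|v i| <= B) -> (forall k, `|z - x k| <= K) ->
  `|(interpolant x v).[z]| <= #|I|%:R * (B / rho ^+ #|I|.-1 * K ^+ #|I|.-1).
Proof.
move=> rho0 B0 sep vB zK; rewrite horner_sum.
apply: (le_trans (ler_norm_sum _ _ _)).
rewrite mulr_natl -sumr_const; apply: ler_sum => i _.
rewrite hornerZ normrM normrM normfV.
apply: ler_pM; rewrite ?mulr_ge0 ?invr_ge0 //.
- apply: ler_pM; rewrite ?invr_ge0 //.
  rewrite lef_pV2 ?posrE ?exprn_gt0 //; last first.
    apply: (lt_le_trans (exprn_gt0 #|I|.-1 rho0)).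
    by apply: le_norm_prod => [|k ki]; [exact: ltW | rewrite sep // eq_sym].
  by apply: le_norm_prod => [|k ki]; [exact: ltW | rewrite sep // eq_sym].
- rewrite horner_prod; apply: norm_prod_le => k _.
  by rewrite hornerXsubC.
Qed.

(** At [x i + r] and [x i - r] the unperturbed product takes opposite signs and
dominates [V], so the intermediate value theorem gives a root in between.
These intervals are disjoint, so this accounts for all the roots. *)
Lemma perturbed_real_roots (I : finType) (x : I -> R) (V : {poly R}) (r rho : R) :
  0 < r -> r <= rho / 2 -> (forall i k, i != k -> rho <= `|x i - x k|) ->
  (size V <= #|I|)%N ->
  (forall i z, `|z - x i| <= r -> `|V.[z]| < r * (rho / 2) ^+ #|I|.-1) ->
  exists y : I -> R, (forall i, `|y i - x i| < r) /\
    \prod_k ('X - (x k)%:P) + V = \prod_k ('X - (y k)%:P).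
Proof.
move=> r0 r_rho sep sV Vsmall.
pose Q := \prod_k ('X - (x k)%:P).
have QE z : Q.[z] = \prod_k (z - x k).
  by rewrite horner_prod; apply: eq_bigr => k _; rewrite hornerXsubC.
have sQ : size Q = #|I|.+1 by rewrite /Q -big_enum size_prod_XsubC -cardE.
have root i : exists z, `|z - x i| < r /\ root (Q + V) z.
  pose u := \prod_(k | k != i) (x i + r - x k).
  pose w := \prod_(k | k != i) (x i - r - x k).
  have far s k : `|s| <= r -> k != i -> rho / 2 <= `|x i + s - x k|.
    move=> sr ki; have := sep i k; rewrite eq_sym ki => /(_ isT).
    have := ler_normB (x i + s - x k) s; rewrite (_ : _ - s = x i - x k); last by ring.
    lra.
  have uw0 : 0 < u * w.
    rewrite -big_split; apply: prodr_gt0 => k ki /=.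
    have := sep i k; rewrite eq_sym ki => /(_ isT) d.
    have : rho ^+ 2 <= (x i - x k) ^+ 2.
      by rewrite -[leRHS]real_normK ?num_real // lerXn2r // ?nnegrE; lra.
    nra.
  have u1 : (rho / 2) ^+ #|I|.-1 <= `|u|.
    by apply: le_norm_prod => [|k]; [lra | apply: far; rewrite gtr0_norm].
  have w1 : (rho / 2) ^+ #|I|.-1 <= `|w|.
    by apply: le_norm_prod => [|k]; [lra | apply: far; rewrite normrN gtr0_norm].
  have Qr : Q.[x i + r] = r * u by rewrite QE (bigD1 i) //=; congr (_ * _); ring.
  have Ql : Q.[x i - r] = - r * w by rewrite QE (bigD1 i) //=; congr (_ * _); ring.
  have Vr : `|V.[x i + r]| < r * `|u|.
    apply: lt_le_trans (Vsmall i _ _) _; first by rewrite addrAC subrr add0r gtr0_norm.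
    by rewrite ler_pM2l.
  have Vl : `|V.[x i - r]| < r * `|w|.
    apply: lt_le_trans (Vsmall i _ _) _.
      by rewrite addrAC subrr add0r normrN gtr0_norm.
    by rewrite ler_pM2l.
  have [||z] := @poly_ivtoo _ (Q + V) (x i - r) (x i + r); first lra.
    rewrite !hornerD Qr Ql; move: Vr Vl uw0.
    set a := V.[_]; set b := V.[_]; rewrite !ltr_norml => /andP[a1 a2] /andP[b1 b2] uw0.
    have [u0|u0] := leP 0 u.
      have w0 : 0 < w by nra.
      move: a1 a2 b1 b2; rewrite ger0_norm // (gtr0_norm w0) => a1 a2 b1 b2.
      by rewrite nmulr_rlt0; nra.
    have w0 : w < 0 by nra.
    move: a1 a2 b1 b2; rewrite !ltr0_norm // => a1 a2 b1 b2.
    by rewrite pmulr_rlt0; nra.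
  rewrite in_itv /= => /andP[z1 z2] zroot; exists z; split=> //.
  by rewrite ltr_norml; lra.
have [y yP] := fin_all_exists root; exists y; split=> [i|]; first by have [] := yP i.
have y_inj : injective y.
  move=> i k yik; apply/eqP; apply: contraT => ik.
  have := sep i k ik; have [yi _] := yP i; have [yk _] := yP k.
  have := ler_normD (x i - y i) (y k - x k).
  rewrite {1}yik addrA addrNK (distrC (x i) (y i)) => tri d.
  suff: rho < rho by rewrite ltxx.
  lra.
rewrite (@all_roots_prod_XsubC _ (Q + V) [seq y i | i <- enum I]).
- rewrite lead_coefDl ?sQ // lead_coef_prod_XsubC scale1r big_map.
  by rewrite -[LHS]big_filter filter_predT big_enum.
- by rewrite size_polyDl sQ // [in RHS]size_map -cardE.
- by apply/allP => _ /mapP[i _ ->]; have [] := yP i.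
- by rewrite uniq_rootsE map_inj_uniq // enum_uniq.
Qed.

(** Each of the fewer than [#|I|] factors loses at most [(1 + e) ^+ 2], and [e] is
so small that the total loss is at most [2]. *)
Lemma prod_le_double (I : finType) (i : I) (e : R) (f g : I -> R) :
  0 <= e -> (#|I|.*2)%:R * e <= 1 / 2 ->
  (forall k, k != i -> 0 <= f k /\ f k <= (1 + e) ^+ 2 * g k) ->
  \prod_(k | k != i) f k <= 2 * \prod_(k | k != i) g k.
Proof.
move=> e0 Ie fg.
have e1 : 0 < (1 + e) ^+ 2 by rewrite exprn_gt0 //; lra.
have g0 : 0 <= \prod_(k | k != i) g k.
  apply: prodr_ge0 => k /fg[f0 fgk].
  by rewrite -(pmulr_rge0 _ e1) (le_trans f0).
apply: (@le_trans _ _ (\prod_(k | k != i) ((1 + e) ^+ 2 * g k))).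
  by apply: ler_prod => k /fg[-> ->].
rewrite big_split /= prodr_const cardC1; apply: ler_wpM2r => //.
rewrite -exprM; apply: le_trans (_ : (1 + e) ^+ #|I|.*2 <= _).
  by rewrite ler_weXn2l //; [lra | rewrite -muln2 mulnC leq_mul2r leq_pred].
by apply: (le_trans (exprD1_le e0 Ie)); lra.
Qed.

Lemma dist_le_dilate (D r e u v : R) :
  0 <= e -> r <= e * D -> D <= `|v| -> `|u - v| <= r -> `|u| <= (1 + e) * `|v|.
Proof.
move=> e0 re Dv uv; have := ler_normD (u - v) v; rewrite subrK.
have := ler_wpM2l e0 Dv; lra.
Qed.

(** Up to sign, the two amplitudes are [t] divided by a product of distances; the
distance between [x i] and [y i] occurs in both and cancels, and each other
distance changes by a factor at most [1 + e].  The statement is symmetric in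
[x] and [y] up to the sign of [t], so it also bounds the ratio from below. *)
Lemma matching_amplitude_le (I : finType) (x y : I -> R) (t D r e : R) (i : I) :
  0 < D -> 0 <= e -> r <= e * D -> (#|I|.*2)%:R * e <= 1 / 2 ->
  (forall k, k != i -> [/\ D <= `|x i - x k|, D <= `|x i - y k|,
                           D <= `|y i - x k| & D <= `|y i - y k|]) ->
  `|y i - x i| <= r -> x i != y i ->
  `|matching_amplitude (- t) y x i| <= 2 * `|matching_amplitude t x y i|.
Proof.
move=> D0 e0 re Ie far yx_r xy.
pose P := nodal_weight x i * \prod_(k | k != i) (x i - y k).
pose Q := nodal_weight y i * \prod_(k | k != i) (y i - x k).
have neq0 (z : R) : D <= `|z| -> z != 0 by move/(lt_le_trans D0); rewrite normr_gt0.
have P0 : P != 0.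
  by rewrite mulf_neq0 //; apply/prodf_neq0 => k /far[? ? ? ?]; exact: neq0.
have Q0 : Q != 0.
  by rewrite mulf_neq0 //; apply/prodf_neq0 => k /far[? ? ? ?]; exact: neq0.
have PQ : `|P| <= 2 * `|Q|.
  rewrite /P /Q [X in _ <= 2 * `|X|]mulrC !normrM !normr_prod -!big_split /=.
  apply: (prod_le_double e0 Ie) => k /far[d1 d2 d3 d4].
  rewrite mulr_ge0 // expr2 mulrACA; split=> //.
  have close (u : R) : `|x i - u - (y i - u)| <= r.
    by rewrite (_ : _ - _ - _ = - (y i - x i)) ?normrN //; ring.
  by apply: ler_pM => //; apply: (@dist_le_dilate D r).
have xP : matching_amplitude t x y i = t / (P * (x i - y i)).
  by rewrite /matching_amplitude (bigD1 i) //= /P mulrA mulrAC.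
have yQ : matching_amplitude (- t) y x i = t / (Q * (x i - y i)).
  rewrite /matching_amplitude (bigD1 i) //= mulrA mulrAC -/Q -(opprB (x i)).
  by rewrite mulrN invrN mulrNN.
have g0 : 0 < `|x i - y i| by rewrite normr_gt0 subr_eq0.
rewrite {}xP {}yQ; clearbody P Q.
rewrite !normf_div mulrCA; apply: ler_wpM2l => //; rewrite !normrM.
have Pg : 0 < `|P| * `|x i - y i| by rewrite mulr_gt0 // normr_gt0.
have Qg : 0 < `|Q| * `|x i - y i| by rewrite mulr_gt0 // normr_gt0.
rewrite ler_pdivlMr // mulrC ler_pdivrMr //.
by rewrite mulrA ler_wpM2r.
Qed.

Lemma dist_perturbation_ge (I : finType) (x y : I -> R) (q r : R) (i k : I) :
  r <= q / 4 -> q <= `|x i - x k| -> (forall j, `|y j - x j| <= r) ->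
  [/\ q / 2 <= `|x i - x k|, q / 2 <= `|x i - y k|,
      q / 2 <= `|y i - x k| & q / 2 <= `|y i - y k|].
Proof.
move=> rq d yx.
have nearby (u : R) : `|x i - x k - u| <= 2 * r -> q / 2 <= `|u|.
  by have := ler_normD (x i - x k - u) u; rewrite subrK; lra.
have := yx i; have := yx k; rewrite !ler_norml => /andP[? ?] /andP[? ?].
by split; apply: nearby; rewrite ler_norml; lra.
Qed.

(** The formula for [a] expresses [x i - y i] as [t / (a * Z)], where [Z] is a
product of distances and is positive since each [y k] lies on the same side of
[x i] as [x k].  The sign chosen for [t] makes the node move in the direction
[s]. *)
Lemma matching_displacement (I : finType) (x y : I -> R) (a t s eps q M : R) (i : I) :
  (forall k, k != i -> q <= `|x i - x k|) -> (forall k, `|y k - x k| < q) ->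
  (forall k, `|x i - x k| <= 1) -> (forall k, `|x i - y k| <= 2) ->
  a = matching_amplitude t x y i -> a != 0 -> `|a| <= M -> x i != y i ->
  s ^+ 2 = 1 -> t = - s * eps * Num.sg a -> 0 < eps ->
  eps / (M * 2 ^+ #|I|.-1) <= s * (y i - x i).
Proof.
move=> sep yx_q x1 y2 aE a0 aM xy s1 tE eps0.
pose P := \prod_(k | k != i) (x i - y k).
have Z0 : 0 < nodal_weight x i * P.
  rewrite -big_split; apply: prodr_gt0 => k ki /=.
  have := sep k ki; have := yx_q k; rewrite ltr_norml => /andP[k1 k2].
  have [d0|d0] := leP 0 (x i - x k).
    by rewrite ger0_norm // => dq; rewrite mulr_gt0 //; lra.
  by rewrite ltr0_norm // => dq; rewrite nmulr_rgt0 //; lra.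
have Z2 : `|a| * (nodal_weight x i * P) <= M * 2 ^+ #|I|.-1.
  apply: ler_pM => //; first exact: ltW.
  rewrite -(gtr0_norm Z0) normrM -[leRHS]mul1r; apply: ler_pM => //.
    by rewrite -[leRHS](expr1n _ #|I|.-1); apply: norm_prod_le.
  exact: norm_prod_le.
have aZ : a * (nodal_weight x i * P) * (x i - y i) = t.
  rewrite {1}aE /matching_amplitude (bigD1 i) //= -/P -mulrA.
  rewrite [_ * P * _]mulrAC -(mulrA _ _ P) divfK // [_ * P]mulrC mulrA.
  by rewrite mulf_neq0 ?subr_eq0 // gt_eqF.
have eZ : `|a| * (nodal_weight x i * P) * (s * (y i - x i)) = eps.
  have sg1 : Num.sg a ^+ 2 = 1 by rewrite sqr_sg a0.
  transitivity (- s * Num.sg a * (a * (nodal_weight x i * P) * (x i - y i))).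
    by rewrite normrEsg; ring.
  rewrite aZ tE; transitivity (s ^+ 2 * Num.sg a ^+ 2 * eps); first by ring.
  by rewrite s1 sg1 !mul1r.
have aZ0 : 0 < `|a| * (nodal_weight x i * P) by rewrite mulr_gt0 // normr_gt0.
rewrite ler_pdivrMr; last exact: lt_le_trans Z2.
have sy0 : 0 <= s * (y i - x i) by rewrite -(pmulr_rge0 _ aZ0) eZ ltW.
by rewrite -[leLHS]eZ [leRHS]mulrC; apply: ler_wpM2r.
Qed.

(** The constant is uniform over all configurations: the nodes move by at most
[r], a fixed fraction of the separation, as soon as [t] has absolute value
[eps], and [eps] bounds the displacement from below.  The direction [s] of the
displacement of the node [i0] may be prescribed; the proof gives [t] the sign
of [- s * a i0] for this purpose. *)
Lemma exists_matching_perturbation (m M rho : R) (n : nat) :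
  0 < m -> m <= M -> 0 < rho -> (0 < n)%N ->
  exists2 C : R, 0 < C &
    forall (I : finType) (x a : I -> R) (i0 : I) (s : R),
      #|I| = n -> (forall i, 0 <= x i <= 1) ->
      (forall i k, i != k -> rho <= `|x i - x k|) ->
      (forall i, m <= `|a i| <= M) -> s ^+ 2 = 1 ->
    exists y b : I -> R,
      [/\ forall i, `|y i - x i| <= Num.min rho 1 / 4,
          forall i, m / 2 <= `|b i| <= 2 * M,
          C <= s * (y i0 - x i0) &
          forall p : {poly R}, (size p < n.*2)%N ->
            \sum_i a i * p.[x i] = \sum_i b i * p.[y i]].
Proof.
move=> m0 mM rho0 n0; have M0 : 0 < M by lra.
pose q := Num.min rho 1.
have q0 : 0 < q by rewrite lt_min rho0 ltr01.
have q1 : q <= 1 by rewrite ge_min lexx orbT.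
have nR1 : 1 <= n%:R :> R by rewrite ler1n.
pose e : R := (4 * n%:R)^-1.
have eE : 4 * n%:R * e = 1 by rewrite mulfV //; lra.
have e0 : 0 < e by rewrite invr_gt0; lra.
have e4 : e <= 1 / 4 by nra.
have two_ne : (n.*2)%:R * e <= 1 / 2 by rewrite -muln2 natrM; lra.
pose r := e * (q / 2).
have r0 : 0 < r by rewrite mulr_gt0 //; lra.
have r4 : r <= q / 4 by rewrite /r; nra.
have rq : r <= q by lra.
have r1 : r <= 1 by lra.
have r2 : r <= q / 2 by lra.
have qn0 : 0 < q ^+ n.-1 by rewrite exprn_gt0.
(* The interpolant of the values t / (a i * w i) is at most `|t| * K near the
   nodes, and the unperturbed product is at least G at distance r of a node. *)
pose K := n%:R * ((m * q ^+ n.-1)^-1 / q ^+ n.-1 * 2 ^+ n.-1).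
have K0 : 0 < K by rewrite !mulr_gt0 ?invr_gt0 ?exprn_gt0 ?mulr_gt0 //; lra.
pose G := r * (q / 2) ^+ n.-1.
have G0 : 0 < G by rewrite mulr_gt0 // exprn_gt0 //; lra.
pose eps := G / (2 * K).
have eps0 : 0 < eps by rewrite divr_gt0 // mulr_gt0.
have epsK : eps * K < G.
  rewrite (_ : eps * K = G / 2); last by rewrite /eps; field; rewrite gt_eqF.
  by lra.
clearbody eps; exists (eps / (M * 2 ^+ n.-1)).
  by rewrite divr_gt0 // mulr_gt0 // exprn_gt0.
move=> I x a i0 s cardI x01 sep_rho aB s1.
have sep i k : i != k -> q <= `|x i - x k|.
  by move=> ik; rewrite (le_trans _ (sep_rho i k ik)) // ge_min lexx.
have x_inj : injective x.
  move=> i k xik; apply/eqP; apply: contraT => /sep.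
  by rewrite xik subrr normr0 leNgt q0.
have a_neq0 i : a i != 0.
  by rewrite -normr_gt0 (lt_le_trans m0) //; have /andP[] := aB i.
pose w := nodal_weight x.
have w_neq0 i : w i != 0 by exact: nodal_weight_neq0.
have [t tE] : exists t, t = - s * eps * Num.sg (a i0) by exists (- s * eps * Num.sg (a i0)).
have tN : `|t| = eps.
  rewrite tE normrM normrM normrN normr_sg a_neq0 mulr1 (gtr0_norm eps0).
  suff -> : `|s| = 1 by rewrite mul1r.
  by apply/eqP; rewrite -(@eqrXn2 _ 2) // real_normK ?num_real // s1 expr1n.
have t_neq0 : t != 0 by rewrite -normr_gt0 tN.
pose v i := t / (a i * w i).
have v_neq0 i : v i != 0.
  by rewrite /v mulf_eq0 invr_eq0 mulf_eq0 !negb_or t_neq0 a_neq0 w_neq0.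
have vB i : `|v i| <= eps / (m * q ^+ n.-1).
  rewrite /v normf_div tN [`|_ * w i|]normrM ler_pM2l //.
  rewrite lef_pV2 ?posrE ?mulr_gt0 ?normr_gt0 //.
  apply: ler_pM; [exact: ltW | exact: ltW | by have /andP[] := aB i | ].
  by rewrite -cardI; apply: le_norm_prod => [|k ki]; [exact: ltW | rewrite sep // eq_sym].
have xx1 i k : `|x i - x k| <= 1.
  by have := x01 i; have := x01 k; clear; rewrite ler_norml; lra.
have Vsmall i z : `|z - x i| <= r -> `|(interpolant x v).[z]| < G.
  move=> zi; apply: le_lt_trans epsK.
  have zk k : `|z - x k| <= 2.
    rewrite -(subrK (x i) z) -addrA (le_trans (ler_normD _ _)) //.
    by rewrite (_ : 2 = 1 + 1) // lerD // (le_trans zi).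
  have eB : 0 <= eps / (m * q ^+ n.-1) by rewrite ltW // divr_gt0 // mulr_gt0.
  have := @horner_interpolant_le I x v q _ 2 z q0 eB sep vB zk; rewrite cardI.
  by move/le_trans; apply; rewrite /K le_eqVlt; apply/orP; left; apply/eqP; ring.
have [y [yx_r yE]] : exists y : I -> R, (forall i, `|y i - x i| < r) /\
    \prod_k ('X - (x k)%:P) + interpolant x v = \prod_k ('X - (y k)%:P).
  apply: (perturbed_real_roots r0 r2 sep (size_interpolant _ _)) => i z.
  by rewrite cardI; exact: Vsmall.
have prodE i : \prod_k (x i - y k) = v i.
  have := congr1 (fun p : {poly R} => p.[x i]) yE.
  rewrite hornerD interpolantE // !horner_prod (bigD1 i) //=.
  rewrite hornerXsubC subrr mul0r add0r => ->.
  by apply: eq_bigr => k _; rewrite hornerXsubC.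
have xy i k : x i != y k.
  by apply: contraNneq (v_neq0 i) => xyik; rewrite -prodE (bigD1 k) //= xyik subrr mul0r.
have aE i : a i = matching_amplitude t x y i.
  rewrite /matching_amplitude prodE /v -/(w i); field.
  by rewrite a_neq0 w_neq0 t_neq0.
have yx_le i : `|y i - x i| <= r by exact: ltW.
have far i k : k != i -> [/\ q / 2 <= `|x i - x k|, q / 2 <= `|x i - y k|,
                            q / 2 <= `|y i - x k| & q / 2 <= `|y i - y k|].
  by move=> ki; apply: (dist_perturbation_ge r4) => //; rewrite sep // eq_sym.
have q2 : 0 < q / 2 by rewrite divr_gt0.
have y_inj : injective y.
  move=> i k yik; apply/eqP; apply: contraT; rewrite eq_sym => /far[_ _ _].
  by rewrite yik subrr normr0 leNgt q2.
exists y, (matching_amplitude (- t) y x); split.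
- by move=> i; exact: le_trans r4.
- move=> i; have /andP[am aM] := aB i.
  have := @matching_amplitude_le I x y t (q / 2) r e i.
  have := @matching_amplitude_le I y x (- t) (q / 2) r e i.
  rewrite cardI opprK -aE distrC eq_sym => le1 le2; apply/andP; split.
    have : `|a i| <= 2 * `|matching_amplitude (- t) y x i|.
      by apply: le1 => //; [exact: ltW | move=> k /far[? ? ? ?]; split].
    by clear -am; lra.
  apply: le_trans (ler_wpM2l _ aM) => //.
  by apply: le2 => //; [exact: ltW | exact: far].
- have /andP[_ aM] := aB i0; rewrite -cardI.
  apply: (@matching_displacement I x y (a i0) t s eps q M i0) => //.
  + by move=> k ki; apply: sep; rewrite eq_sym.
  + by move=> k; apply: (lt_le_trans (yx_r k)).
  + move=> k; rewrite -(subrK (x k) (x i0)) -addrA (le_trans (ler_normD _ _)) //.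
    by rewrite (_ : 2 = 1 + 1) // lerD // distrC (le_trans (yx_le k)).
- move=> p sp; rewrite -(matching_moments t x_inj y_inj xy) ?cardI //.
  by apply: eq_bigr => i _; rewrite aE.
Qed.

End Perturbation.

(** * Taylor polynomials of cosine and sine *)

Section TrigonometricTaylor.
Variables (R : realType).

Lemma norm_le_of_derive (f df : R -> R) (n : nat) (t : R) :
  (forall u : R, is_derive u 1 f (df u)) -> f 0 = 0 ->
  (forall u, `|df u| <= `|u| ^+ n) -> `|f t| <= `|t| ^+ n.+1.
Proof.
move=> fdf f0 df_le.
have fcont (i : interval R) :
    continuous (from_subspace (classical_sets.mkset (fun u : R => u \in i)) f).
  by apply: derivable_within_continuous => u _; have [] := fdf u.
have concl c : `|c| <= `|t| -> `|f t| = `|df c * t| -> `|f t| <= `|t| ^+ n.+1.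
  move=> ct ->; rewrite normrM exprSr; apply: ler_wpM2r => //.
  by apply: (le_trans (df_le c)); rewrite lerXn2r.
have [t0|t0] := leP 0 t.
  have [c] := MVT_segment t0 (fun u _ => fdf u) (fcont _).
  rewrite in_itv /= f0 !subr0 => /andP[c0 ct] ft; apply: (concl c).
    by rewrite !ger0_norm.
  by rewrite ft.
have [c] := MVT_segment (ltW t0) (fun u _ => fdf u) (fcont _).
rewrite in_itv /= f0 !sub0r => /andP[tc c0] ft; apply: (concl c).
  by rewrite (ler0_norm c0) (ltr0_norm t0) lerN2.
by rewrite -normrN ft mulrN normrN.
Qed.

(** The coefficient of degree [0] vanishes because [0^-1 = 0]. *)
Definition antiderivative (p : {poly R}) : {poly R} :=
  \poly_(i < (size p).+1) (p`_i.-1 / i%:R).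

Lemma deriv_antiderivative p : (antiderivative p)^`() = p.
Proof.
apply/polyP => i; rewrite coef_deriv coef_poly ltnS /=.
case: ltnP => [_|pi]; last by rewrite mul0rn nth_default.
by rewrite -[LHS]mulr_natr divfK // pnatr_eq0.
Qed.

Lemma antiderivative_at0 p : (antiderivative p).[0] = 0.
Proof. by rewrite horner_coef0 coef_poly /= invr0 mulr0. Qed.

Lemma size_antiderivative p : (size (antiderivative p) <= (size p).+1)%N.
Proof. exact: size_poly. Qed.

(** Each step integrates the previous approximations; the mean value theorem
raises the order of the remainder by one. *)
Lemma cos_sin_taylor n : exists p q : {poly R},
  [/\ (size p <= n)%N, (size q <= n)%N,
      forall t, `|cos t - p.[t]| <= `|t| ^+ n &
      forall t, `|sin t - q.[t]| <= `|t| ^+ n].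
Proof.
elim: n => [|n [p [q [sp sq cp sq']]]].
  exists 0, 0; rewrite size_poly0; split=> // t; rewrite horner0 subr0 expr0.
    by rewrite ler_norml cos_geN1 cos_le1.
  by rewrite ler_norml sin_geN1 sin_le1.
exists (1 - antiderivative q), (antiderivative p); split.
- rewrite (leq_trans (size_polyD _ _)) // geq_max size_poly1 size_polyN.
  by rewrite (leq_trans (size_antiderivative _)).
- by rewrite (leq_trans (size_antiderivative _)).
- move=> t; apply: (@norm_le_of_derive (fun u => cos u - (1 - antiderivative q).[u])
    (fun u => - sin u - (1 - antiderivative q)^`().[u])).
  + by rewrite /= cos0 hornerD hornerN antiderivative_at0 hornerE subr0 subrr.
  + move=> u; rewrite derivB derivC deriv_antiderivative sub0r hornerN.
    by rewrite -opprD normrN.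
- move=> t; apply: (@norm_le_of_derive (fun u => sin u - (antiderivative p).[u])
    (fun u => cos u - (antiderivative p)^`().[u])).
  + by rewrite /= sin0 antiderivative_at0 subr0.
  + by move=> u; rewrite deriv_antiderivative.
Qed.

End TrigonometricTaylor.

(** * Spectra of signals with equal moments *)

Section Spectrum.
Variables (R : realType).

Lemma expiD (s t : R) : expi (s + t) = expi s * expi t.
Proof. by rewrite /expi cosD sinD; simpc; congr (_ +i* _)%C; rewrite addrC. Qed.

Lemma norm_expi (t : R) : `|expi t| = 1.
Proof. by rewrite normc_def /= cos2Dsin2 sqrtr1. Qed.

Lemma norm_complex_le (x y : R) : `|(x +i* y)%C| <= (`|x| + `|y|)%:C%C.
Proof.
rewrite normc_def lecR /= -[leRHS]ger0_norm ?addr_ge0 // -sqrtr_sqr.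
rewrite ler_wsqrtr // sqrrD !real_normK ?num_real // -addrA lerD2l lerDr.
by rewrite mulrn_wge0 // mulr_ge0.
Qed.

Lemma fourier_signal (d : nat) (A X : 'rV[R]_d) (s : R) :
  fourier (signal A X) s = \sum_j (A 0 j)%:C%C * expi (- (s * X 0 j)).
Proof. by []. Qed.

Section Matched.
Variables (I : finType) (x y a b : I -> R) (M : R) (n : nat).
Hypotheses (x1 : forall i, `|x i| <= 1) (y2 : forall i, `|y i| <= 2).
Hypotheses (aM : forall i, `|a i| <= M) (bM : forall i, `|b i| <= 2 * M).
Hypothesis (n_gt0 : (0 < n)%N).
Hypothesis matched : forall p : {poly R}, (size p <= n)%N ->
  \sum_i a i * p.[x i] = \sum_i b i * p.[y i].

(** The polynomial [p] composed with the multiplication by [t] cancels in the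
difference, so [f] may be replaced by its remainder [f - p]. *)
Lemma matched_difference_le (f : R -> R) (p : {poly R}) (t : R) :
  (size p <= n)%N -> (forall u, `|f u - p.[u]| <= `|u| ^+ n) ->
  `|\sum_i a i * f (t * x i) - \sum_i b i * f (t * y i)|
    <= #|I|%:R * (M * (1 + 2 * 2 ^+ n)) * `|t| ^+ n.
Proof.
move=> sp fp.
have sizeq : (size (p \Po (t *: 'X)) <= n)%N.
  have sX : (size (t *: 'X) <= 2)%N.
    by rewrite (leq_trans (size_scale_leq _ _)) ?size_polyX.
  rewrite (leq_trans (size_comp_poly_leq _ _)) //.
  move: sp sX n_gt0; case: (size p) => [|u]; case: (size _) => [|[|[|v]]] //=; lia.
have qE z : (p \Po (t *: 'X)).[z] = p.[t * z].
  by rewrite horner_comp hornerZ hornerX.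
have := matched sizeq; under eq_bigr do rewrite qE; under [RHS]eq_bigr do rewrite qE.
move=> pE.
have -> : \sum_i a i * f (t * x i) - \sum_i b i * f (t * y i) =
    \sum_i (a i * (f (t * x i) - p.[t * x i]) - b i * (f (t * y i) - p.[t * y i])).
  rewrite sumrB; under [in RHS]eq_bigr do rewrite mulrBr.
  under [X in _ = _ - X]eq_bigr do rewrite mulrBr.
  by rewrite !sumrB pE; ring.
apply: (le_trans (ler_norm_sum _ _ _)).
rewrite -mulrA mulr_natl -sumr_const; apply: ler_sum => i _.
apply: (le_trans (ler_normB _ _)); rewrite !normrM.
have M0 : 0 <= M by rewrite (le_trans _ (aM i)).
have -> : M * (1 + 2 * 2 ^+ n) * `|t| ^+ n =
  M * `|t| ^+ n + 2 * M * (2 ^+ n * `|t| ^+ n) by ring.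
apply: lerD; apply: ler_pM => //; apply: (le_trans (fp _)).
  rewrite lerXn2r // ?nnegrE // normrM -[leRHS]mulr1.
  by rewrite ler_wpM2l.
rewrite -exprMn lerXn2r // ?nnegrE // ?mulr_ge0 // normrM mulrC.
by rewrite ler_wpM2r.
Qed.

(** The factor [2] is the cost of adding real and imaginary parts. *)
Lemma matched_spectrum_le (t : R) :
  `|\sum_i (a i)%:C%C * expi (t * x i) - \sum_i (b i)%:C%C * expi (t * y i)|
    <= (2 * (#|I|%:R * (M * (1 + 2 * 2 ^+ n))) * `|t| ^+ n)%:C%C.
Proof.
have [p [q [sp sq cp sq']]] := cos_sin_taylor R n.
have sumE (c z : I -> R) : \sum_i (c i)%:C%C * expi (t * z i) =
    ((\sum_i c i * cos (t * z i)) +i* (\sum_i c i * sin (t * z i)))%C.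
  apply/eqP; rewrite eq_complex !raddf_sum /=; apply/andP; split; apply/eqP;
  by apply: eq_bigr => i _; rewrite /expi; simpc.
have subE (u v u' v' : R) : (u +i* v)%C - (u' +i* v')%C = ((u - u') +i* (v - v'))%C.
  by simpc.
rewrite !sumE subE; apply: (le_trans (norm_complex_le _ _)).
rewrite lecR -mulrA [2 * _]mulr_natl mulr2n; apply: lerD.
  exact: matched_difference_le sp cp.
exact: matched_difference_le sq sq'.
Qed.

End Matched.
End Spectrum.

(** * Sorting the nodes of a signal *)

Section Sorting.
Variables (R : realType) (d : nat).
Implicit Types (X A : 'rV[R]_d) (s : 'S_d).

Lemma exists_sorting_perm X : exists s, ordered_nodes (col_perm s X).
Proof.
pose t := [tuple X 0 i | i < d].
have : perm_eq (sort_tuple <=%R t) t by rewrite perm_sort.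
case/tuple_permP => s sE; exists s => i j ij; rewrite !mxE.
have nthE (k : 'I_d) : nth 0 (sort <=%R t) k = X 0 (s k).
  have -> : sort <=%R t = [tuple tnth t (s i) | i < d] by rewrite -sE.
  by rewrite -tnth_nth !tnth_mktuple.
rewrite -!nthE; apply: (sorted_leq_nth le_trans le_refl) => //.
- by apply: sort_sorted => u v; exact: le_total.
- by rewrite inE size_sort size_tuple.
- by rewrite inE size_sort size_tuple.
Qed.

(** Otherwise [s] would inject the [k + 1] indices up to [k] into the [k] indices
below [k]. *)
Lemma perm_exceeds s (k : 'I_d) : exists2 j : 'I_d, (j <= k)%N & (k <= s j)%N.
Proof.
have [/existsP[j /andP[jk ksj]]|/existsPn no] :=
  boolP [exists j : 'I_d, (j <= k)%N && (k <= s j)%N]; first by exists j.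
have sub : s @: [set j : 'I_d | (j <= k)%N] \subset [set j : 'I_d | (j < k)%N].
  apply/subsetP => z /imsetP[j jk ->]; move: jk; rewrite !inE => jk.
  by have := no j; rewrite jk -ltnNge.
have := subset_leq_card sub; rewrite card_imset; last exact: perm_inj.
have -> : [set j : 'I_d | (j <= k)%N] = k |: [set j : 'I_d | (j < k)%N].
  by apply/setP => j; rewrite !inE leq_eqVlt.
by rewrite cardsU1 inE ltnn ltnn.
Qed.

Lemma sorted_ge X s (k : 'I_d) (z : R) :
  ordered_nodes (col_perm s X) -> (forall j : 'I_d, (k <= j)%N -> z <= X 0 j) ->
  z <= col_perm s X 0 k.
Proof.
move=> ord zX; have [j jk ksj] := perm_exceeds s k.
by apply: le_trans (ord _ _ jk); rewrite mxE zX.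
Qed.

(** The mirror image of [sorted_ge], by applying [perm_exceeds] to the inverse. *)
Lemma sorted_le X s (k : 'I_d) (z : R) :
  ordered_nodes (col_perm s X) -> (forall j : 'I_d, (j <= k)%N -> X 0 j <= z) ->
  col_perm s X 0 k <= z.
Proof.
move=> ord Xz; have [j jk ksj] := perm_exceeds s^-1%g k.
by apply: le_trans (ord _ _ ksj) _; rewrite mxE permKV Xz.
Qed.

Lemma fourier_signal_perm s A X (u : R) :
  fourier (signal (col_perm s A) (col_perm s X)) u = fourier (signal A X) u.
Proof.
rewrite !fourier_signal [in RHS](reindex_inj (@perm_inj _ s)).
by apply: eq_bigr => j _; rewrite !mxE.
Qed.

End Sorting.

(** * Replacing the nodes of a cluster *)

Section Cluster.
Variables (R : realType) (d k l : nat) (hkl : (k + l <= d)%N).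

Definition cluster_node (s : 'I_l) : 'I_d := widen_ord hkl (rshift k s).

Lemma sum_cluster (V : nmodType) (G : 'I_d -> V) :
  (0 < l)%N -> (forall j : 'I_d, ~~ (k <= j < k + l)%N -> G j = 0) ->
  \sum_j G j = \sum_s G (cluster_node s).
Proof.
move=> l_gt0 G0; rewrite (bigID (fun j : 'I_d => (k <= j < k + l)%N)) /=.
rewrite [X in _ + X]big1 // addr0.
pose f (j : 'I_d) : 'I_l := insubd (Ordinal l_gt0) (j - k)%N.
have fK (j : 'I_d) : (k <= j < k + l)%N -> cluster_node (f j) = j.
  move=> /andP[kj jl]; apply/val_inj; rewrite /= val_insubd.
  by rewrite -(ltn_add2l k) subnKC // jl subnKC.
rewrite (reindex_onto cluster_node f fK); apply: eq_bigl => s.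
rewrite leq_addr ltn_add2l ltn_ord /=; apply/eqP/val_inj.
by rewrite /= val_insubd /= addKn ltn_ord.
Qed.

Definition replace_cluster (v : 'I_l -> R) (X : 'rV[R]_d) : 'rV[R]_d :=
  \row_j if [pick s | cluster_node s == j] is Some s then v s else X 0 j.

Lemma replace_cluster_in v X s : replace_cluster v X 0 (cluster_node s) = v s.
Proof.
rewrite mxE; case: pickP => [s' /eqP|/(_ s)]; last by rewrite eqxx.
by move/(congr1 val)/addnI/val_inj ->.
Qed.

Lemma replace_cluster_out v X (j : 'I_d) :
  ~~ (k <= j < k + l)%N -> replace_cluster v X 0 j = X 0 j.
Proof.
move=> out; rewrite mxE; case: pickP => // s /eqP sj.
by move: out; rewrite -sj /= leq_addr ltn_add2l ltn_ord.
Qed.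

Lemma cluster_nodeP (j : 'I_d) :
  (k <= j < k + l)%N -> exists s, j = cluster_node s.
Proof.
move=> /andP[kj jl]; have jkl : (j - k < l)%N by rewrite ltn_subLR.
by exists (Ordinal jkl); apply/val_inj; rewrite /= subnKC.
Qed.

Lemma fourier_replace_cluster (A X : 'rV[R]_d) (b y : 'I_l -> R) (u : R) :
  (0 < l)%N ->
  fourier (signal A X) u
    - fourier (signal (replace_cluster b A) (replace_cluster y X)) u =
  \sum_s (A 0 (cluster_node s))%:C%C * expi (- (u * X 0 (cluster_node s)))
    - \sum_s (b s)%:C%C * expi (- (u * y s)).
Proof.
move=> l_gt0; rewrite !fourier_signal -!sumrB sum_cluster //.
  by apply: eq_bigr => s _; rewrite !replace_cluster_in.
by move=> j out; rewrite !replace_cluster_out // subrr.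
Qed.

Variables (h rho : R) (X : 'rV[R]_d) (c : R) (bl br : bool).
Hypotheses (l_gt0 : (0 < l)%N) (X_ord : ordered_nodes X).
Hypothesis clusterE : forall j : 'I_d,
  (X 0 j \in Interval (BSide bl c) (BSide br (c + h))) = (k <= j < k + l)%N.

Lemma cluster_bounds s : c <= X 0 (cluster_node s) <= c + h.
Proof.
have := clusterE (cluster_node s); rewrite /= leq_addr ltn_add2l ltn_ord.
rewrite itv_boundlr => /andP[+ +].
by case: bl; case: br => /=; rewrite !bnd_simp => c1 c2; rewrite ?c1 ?c2 ?ltW.
Qed.

(** By ordering such a node is at least the first node of the cluster, so the
only way for it to miss the interval is on the right. *)
Lemma right_of_cluster (j : 'I_d) : (k + l <= j)%N -> c + h <= X 0 j.
Proof.
move=> lj; have := clusterE j; rewrite [in RHS]ltnNge lj andbF.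
have k0j : (cluster_node (Ordinal l_gt0) <= j)%N by rewrite /= addn0 (leq_trans _ lj) ?leq_addr.
have := clusterE (cluster_node (Ordinal l_gt0)).
rewrite /= leq_addr ltn_add2l l_gt0 !itv_boundlr => /andP[c1 _].
rewrite (le_trans c1) ?bnd_simp ?X_ord //=.
by case: br => /=; rewrite !bnd_simp => /negbT; rewrite -?leNgt -?ltNge => // /ltW.
Qed.

Lemma left_of_cluster (j : 'I_d) : (j < k)%N -> X 0 j <= c.
Proof.
move=> jk; have := clusterE j; rewrite [in RHS]leqNgt jk /=.
have k0j : (j <= cluster_node (Ordinal l_gt0))%N by rewrite /= addn0 ltnW.
have := clusterE (cluster_node (Ordinal l_gt0)).
rewrite /= leq_addr ltn_add2l l_gt0 !itv_boundlr => /andP[_ c2].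
rewrite andbC (le_trans _ c2) ?bnd_simp ?X_ord //=.
by case: bl => /=; rewrite !bnd_simp => /negbT; rewrite -?leNgt -?ltNge => // /ltW.
Qed.

End Cluster.

(** * The perturbed signal *)

Theorem mainTheorem1 (R : realType) (m M rho : R) (l : nat)
    (hm : 0 < m) (hmM : m <= M) (hrho : 0 < rho) (hl : (1 <= l)%N) :
  exists C1 C2 : R, 0 < C1 /\ 0 < C2 /\
    forall (d : nat) (h : R) (A0 X0 : 'rV[R]_d) (k : nat)
           (hkl : (k + l <= d)%N),
      (l <= d)%N -> 0 < h ->
      ordered_nodes X0 -> amplitude_bounds m M A0 -> cluster h rho X0 hkl ->
      exists A1 X1 : 'rV[R]_d,
        ordered_nodes X1 /\ amplitude_bounds (m / 2) (2 * M) A1 /\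
        C1 * h <= dist_nodes (subnodes hkl X0) (subnodes hkl X1) /\
        (forall s : R, `|s| <= 1 / (2 * pi * h) ->
           `|fourier (signal A0 X0) s - fourier (signal A1 X1) s|
             <= (C2 * `|h * s| ^+ (2 * l - 1))%:C%C) /\
        (forall N : R, N <= 1 / (2 * pi * h) ->
           forall s : R, - N <= s <= N ->
           `|fourier (signal A0 X0) s - fourier (signal A1 X1) s|
             <= (C2 * (h * N) ^+ (2 * l - 1))%:C%C).
Proof.
have [C1 C1_gt0 perturb] := exists_matching_perturbation hm hmM hrho hl.
have M_gt0 : 0 < M by lra.
set n := (2 * l - 1)%N.
have n_gt0 : (0 < n)%N by rewrite /n; lia.
exists C1, (2 * (l%:R * (M * (1 + 2 * 2 ^+ n)))); split=> //; split.
  have : 0 < 2 ^+ n :> R by rewrite exprn_gt0.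
  by move=> n2; rewrite !mulr_gt0 ?ltr0n //; lra.
move=> d h A0 X0 k hkl _ h_gt0 X0_ord [_ A0B] [[c [bl [br clE]]] sep].
pose i0 := Ordinal hl.
pose node := cluster_node hkl.
pose x s := (X0 0 (node s) - c) / h.
have xE s : X0 0 (node s) = c + h * x s by rewrite /x; field; lra.
have subE X s : subnodes hkl X 0 s = X 0 (node s) by rewrite mxE.
have x01 s : 0 <= x s <= 1.
  have /andP[] := cluster_bounds hkl clE s; rewrite -/(node s) xE.
  rewrite lerDl lerD2l pmulr_rge0 // => ->; by rewrite -[leRHS]mulr1 ler_pM2l.
have x_sep s t : s != t -> rho <= `|x s - x t|.
  move=> /sep; rewrite !subE !xE opprD addrACA subrr add0r -mulrBr normrM.
  by rewrite gtr0_norm // mulrC ler_pM2l.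
have x_first (s : 'I_l) : s != i0 -> x i0 + rho <= x s.
  move=> s0; have : X0 0 (node i0) <= X0 0 (node s).
    by apply: X0_ord; rewrite /= addn0 leq_addr.
  rewrite !xE lerD2l ler_pM2l // => xs.
  by have := x_sep _ _ s0; rewrite ger0_norm ?subr_ge0 //; lra.
pose q := Num.min rho 1.
have q_rho : q <= rho by rewrite ge_min lexx.
have q1 : q <= 1 by rewrite ge_min lexx orbT.
(* The direction in which the first node of the cluster moves: q / 4 bounds its
   displacement, and the nodes outside the cluster on that side must lie
   further away.  A cluster with a second node always has room on the right. *)
have [sg [sg1 room]] : exists sg : R, sg ^+ 2 = 1 /\
    (sg = 1 /\ (forall j : 'I_d, (k + l <= j)%N -> c + h * (x i0 + q / 4) <= X0 0 j) \/
     [/\ sg = -1, l = 1%N &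
        forall j : 'I_d, (j < k)%N -> X0 0 j <= c + h * (x i0 - q / 4)]).
  have [x_small|x_large] := leP (x i0) (3 / 4).
    exists 1; split; first by rewrite expr1n.
    left; split=> // j lj; apply: le_trans (right_of_cluster hkl hl X0_ord clE lj).
    by rewrite lerD2l -[leRHS]mulr1 ler_pM2l //; lra.
  have [l1|l2] := leqP l 1.
    exists (-1); split; first by rewrite sqrrN expr1n.
    right; split=> //; first by apply/eqP; rewrite eqn_leq l1.
    move=> j jk; apply: (le_trans (left_of_cluster hkl hl X0_ord clE jk)).
    by rewrite lerDl pmulr_rge0 //; lra.
  exists 1; split; first by rewrite expr1n.
  left; split=> // j lj; apply: (@le_trans _ _ (X0 0 (node (Ordinal l2)))).
    rewrite xE lerD2l ler_pM2l //; have := x_first (Ordinal l2) isT.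
    have q0 : 0 < q by rewrite lt_min hrho ltr01.
    lra.
  by apply: X0_ord; rewrite /= (leq_trans _ lj) // leq_add2l ltnW.
have [y [b [y_close bB y_moved matched]]] :=
  perturb _ x (fun s => A0 0 (node s)) i0 sg (card_ord l) x01 x_sep (fun s => A0B _) sg1.
pose X1 := replace_cluster hkl (fun s => c + h * y s) X0.
pose A1 := replace_cluster hkl b A0.
have [sigma X1_ord] := exists_sorting_perm X1.
(* Translating by c multiplies both spectra by the same number of modulus 1. *)
have spectrum u : `|fourier (signal A0 X0) u
    - fourier (signal (col_perm sigma A1) (col_perm sigma X1)) u|
    <= (2 * (l%:R * (M * (1 + 2 * 2 ^+ n))) * `|h * u| ^+ n)%:C%C.
  rewrite fourier_signal_perm fourier_replace_cluster //.
  have shiftE z : expi (- (u * (c + h * z))) = expi (- (u * c)) * expi (- (h * u) * z).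
    by rewrite -expiD; congr expi; ring.
  under eq_bigr => s _ do rewrite -/(node s) xE shiftE mulrCA.
  under [X in _ - X]eq_bigr => s _ do rewrite shiftE mulrCA.
  rewrite -!mulr_sumr -mulrBr normrM norm_expi mul1r -(normrN (h * u)).
  have := @matched_spectrum_le _ _ x y (fun s => A0 0 (node s)) b M n.
  rewrite card_ord; apply=> //.
  - by move=> s; have /andP[x0 x1] := x01 s; rewrite ger0_norm.
  - move=> s; have := y_close s; have := x01 s; rewrite -/q !ler_norml; lra.
  - by move=> s; have /andP[] := A0B (node s).
  - by move=> s; have /andP[] := bB s.
  - by move=> p sp; apply: matched; apply: (leq_ltn_trans sp); rewrite /n; lia.
exists (col_perm sigma A1), (col_perm sigma X1); split=> //; split.
  split=> [|j]; first lra.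
  rewrite mxE; have [/cluster_nodeP[s ->]|out] := boolP (k <= sigma j < k + l)%N.
    by rewrite replace_cluster_in.
  by rewrite replace_cluster_out //; have := A0B (sigma j); lra.
split; last first.
  split=> [u _|N _ u uN]; first exact: spectrum.
  apply: (le_trans (spectrum u)); rewrite lecR.
  have u_le : `|u| <= N by rewrite ler_norml.
  apply: ler_wpM2l; first by rewrite !mulr_ge0 // ?addr_ge0 ?mulr_ge0 ?exprn_ge0 // ltW.
  have N_ge0 : 0 <= N by rewrite (le_trans _ u_le).
  apply: lerXn2r; rewrite ?nnegrE // ?mulr_ge0 ?(ltW h_gt0) //.
  by rewrite normrM (gtr0_norm h_gt0) ler_pM2l.
apply: le_trans (le_bigmax _ _ i0); rewrite !subE xE.
have C1h : C1 * h <= h * (sg * (y i0 - x i0)) by rewrite mulrC ler_pM2l.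
have i0E : node i0 = k :> nat by rewrite /= addn0.
have := y_close i0; rewrite -/q ler_norml => /andP[y0_ge y0_le].
have X1_in s : X1 0 (node s) = c + h * y s by rewrite replace_cluster_in.
have X1_out (j : 'I_d) : ~~ (k <= j < k + l)%N -> X1 0 j = X0 0 j.
  exact: replace_cluster_out.
case: room => [[sgE room]|[sgE l1 room]].
- have X1_ge : c + h * y i0 <= col_perm sigma X1 0 (node i0).
    apply: sorted_ge => // j; rewrite i0E => kj.
    have [jl|lj] := ltnP j (k + l)%N.
      have [|s ->] := @cluster_nodeP _ _ _ hkl j; first by rewrite kj.
      rewrite X1_in lerD2l ler_pM2l //; have [->//|s0] := eqVneq s i0.
      have := y_close s; rewrite -/q ler_norml => /andP[ys _].
      have := x_first s s0; lra.
    rewrite X1_out; last by rewrite [(j < _)%N]ltnNge lj andbF.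
    apply: le_trans (room j lj); rewrite lerD2l ler_pM2l //; lra.
  by rewrite sgE in C1h; rewrite distrC ler_normr; apply/orP; left; lra.
- have X1_le : col_perm sigma X1 0 (node i0) <= c + h * y i0.
    apply: sorted_le => // j; rewrite i0E leq_eqVlt => /orP[/eqP jk|jk].
      by rewrite (_ : j = node i0) ?X1_in //; apply: val_inj; exact: etrans jk (esym i0E).
    rewrite X1_out; last by rewrite leqNgt jk.
    apply: (le_trans (room j jk)); rewrite lerD2l ler_pM2l //; lra.
  by rewrite sgE in C1h; rewrite ler_normr; apply/orP; left; lra.
Qed.
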